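(* Let $\mathbb{A} = \mathbb{Q}^+ \cup \{\infty\}$ and $\mathbb{R}_\delta = \mathbb{Q}^+ \cup \{0\}$, and let $\delta \in \mathbb{Q}^+$ be a reference duration value. The reciprocal function $f(x) = \delta/x$ (with $\delta/\infty = 0$ and $\delta/0=\infty$), regarded as a map $\mathbb{A}\to\mathbb{R}_\delta$ and, by the same formula, as a map $\mathbb{R}_\delta\to\mathbb{A}$, is a bijection in each direction, and it preserves the orders $\prec^{\mathcal{A}}$ and $\prec^{\mathcal{R}}$: for all $a,b\in\mathbb{A}$, $a \prec^{\mathcal{A}} b \iff f(a) \prec^{\mathcal{R}} f(b)$, and for all $a,b\in\mathbb{R}_\delta$, $a \prec^{\mathcal{R}} b \iff f(a) \prec^{\mathcal{A}} f(b)$. Moreover, $f$ is a homomorphism: for all $a,b \in \mathbb{R}_\delta$, $$f(a \otimes^{\mathcal{R}} b) = f(a) \otimes^{\mathcal{A}} f(b).$$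
   Context: $\mathbb{Q}^+$ denotes the set of strictly positive rational numbers, and $\infty$ is an additional element larger than every rational number. On $\mathbb{A} = \mathbb{Q}^+\cup\{\infty\}$ (absolute symbolic durations): $a \otimes^{\mathcal{A}} b = \frac{ab}{a+b}$ for $a,b\in\mathbb{Q}^+$, and $a\otimes^{\mathcal{A}}\infty = \infty\otimes^{\mathcal{A}} a = a$ for all $a\in\mathbb{A}$. The strict order of durations is reversed: $a \prec^{\mathcal{A}} b \iff a > b$. On $\mathbb{R}_\delta = \mathbb{Q}^+\cup\{0\}$ (symbolic durations relative to $\delta$): $a\otimes^{\mathcal{R}} b = a+b$, and $a \prec^{\mathcal{R}} b \iff a<b$. *)

(* Defs.v *)
From mathcomp Require Import all_boot all_order all_algebra interval_inference.

Set Implicit Arguments.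
Unset Strict Implicit.
Unset Printing Implicit Defensive.

Import Order.TTheory GRing.Theory Num.Theory.
Local Open Scope ring_scope.

(* A = Q^+ U {oo}, with [None] standing for oo. *)
Definition abs_dur : Type := option {posnum rat}.

(* R_delta = Q^+ U {0}, the nonnegative rationals; the set itself does not
   depend on delta. *)
Definition rel_dur : Type := {nonneg rat}.

(* The numerical order on Q^+ U {oo}, where oo exceeds every rational. *)
Definition abs_lt (a b : abs_dur) : bool :=
  match a, b with
  | Some x, Some y => x%:num < y%:num
  | Some _, None => true
  | None, _ => false
  end.

Definition abs_prec (a b : abs_dur) : bool := abs_lt b a.

Definition rel_prec (a b : rel_dur) : bool := a%:num < b%:num.

Definition abs_tensor (a b : abs_dur) : abs_dur :=
  match a, b with
  | Some x, Some y => Some ((x%:num * y%:num) / (x%:num + y%:num))%:pos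
  | Some _, None => a
  | None, _ => b
  end.

Definition rel_tensor (a b : rel_dur) : rel_dur := (a%:num + b%:num)%:nng.

Definition recip_abs_rel (delta : {posnum rat}) (a : abs_dur) : rel_dur :=
  match a with
  | Some x => (delta%:num / x%:num)%:nng
  | None => 0%:nng
  end.

(* [insub] views [a] as an element of Q^+ when [0 < a], and fails when [a = 0]. *)
Definition recip_rel_abs (delta : {posnum rat}) (a : rel_dur) : abs_dur :=
  match insub a%:num : option {posnum rat} with
  | Some x => Some (delta%:num / x%:num)%:pos
  | None => None
  end.

(* Main.v *)
Require Import Defs.
From mathcomp Require Import all_boot all_order all_algebra interval_inference.
From mathcomp Require Import ring.
Import Order.TTheory GRing.Theory Num.Theory.
Local Open Scope ring_scope.

(** Since δ/(δ/x) = x and 0 and ∞ are exchanged, the two maps are mutually inverse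
    ([recip_abs_relK], [recip_rel_absK]), which gives both bijections. Division into a positive
    constant reverses the numerical order, and so does the definition of [abs_prec]; the two
    reversals cancel. The homomorphism law is the identity δ/(x+y) = (δ/x)(δ/y) / (δ/x + δ/y), with
    the neutral element 0 sent to the neutral element ∞. *)

Lemma recip_rel_abs_eq0 (delta : {posnum rat}) (a : rel_dur) :
  a%:num = 0 -> recip_rel_abs delta a = None.
Proof. by rewrite /recip_rel_abs => ->; case: insubP. Qed.

(** Only numerical values are compared, so the rule applies to any [a] built as a sum or quotient,
    without identifying sign proofs. *)
Lemma recip_rel_abs_pos (delta : {posnum rat}) (a : rel_dur) (x : {posnum rat}) :
  a%:num = x%:num -> recip_rel_abs delta a = Some (delta%:num / x%:num)%:pos.
Proof. by rewrite /recip_rel_abs => ->; rewrite valK. Qed.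

Lemma rel_dur_eq0_or_pos (a : rel_dur) :
  a%:num = 0 \/ exists x : {posnum rat}, a%:num = x%:num.
Proof.
have : 0 <= a%:num by []; rewrite le_eqVlt => /predU1P[<-|a_gt0]; first by left.
by right; exists (PosNum a_gt0).
Qed.

Lemma recip_abs_relK (delta : {posnum rat}) :
  cancel (recip_abs_rel delta) (recip_rel_abs delta).
Proof.
case=> [x|]; last exact: recip_rel_abs_eq0.
rewrite (@recip_rel_abs_pos _ _ (delta%:num / x%:num)%:pos) //.
congr Some; apply/val_inj => /=; field.
by rewrite !gt_eqF.
Qed.

Lemma recip_rel_absK (delta : {posnum rat}) :
  cancel (recip_rel_abs delta) (recip_abs_rel delta).
Proof.
move=> a; apply/val_inj; case: (rel_dur_eq0_or_pos a) => [a0|[x ax]].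
  by rewrite recip_rel_abs_eq0 //= -a0.
rewrite (recip_rel_abs_pos delta a x) //= ax; field.
by rewrite !gt_eqF.
Qed.

Lemma recip_abs_rel_mono (delta : {posnum rat}) (a b : abs_dur) :
  rel_prec (recip_abs_rel delta a) (recip_abs_rel delta b) = abs_prec a b.
Proof.
rewrite /rel_prec /abs_prec.
case: a b => [x|] [y|] //=; rewrite ?ltxx //.
  by rewrite ltr_pM2l // ltf_pV2 ?posrE.
  (* Finite against ∞: δ/x < 0 is false. The next case, ∞ against finite, is 0 < δ/y. *)
  exact/le_gtF.
exact: gt0.
Qed.

Lemma recip_rel_abs_tensor (delta : {posnum rat}) (a b : rel_dur) :
  recip_rel_abs delta (rel_tensor a b) =
  abs_tensor (recip_rel_abs delta a) (recip_rel_abs delta b).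
Proof.
case: (rel_dur_eq0_or_pos a) => [a0|[x ax]].
  rewrite (recip_rel_abs_eq0 _ a) //=.
  by congr recip_rel_abs; apply/val_inj; rewrite /= a0 add0r.
case: (rel_dur_eq0_or_pos b) => [b0|[y bx]].
  rewrite (recip_rel_abs_eq0 _ b) // (_ : rel_tensor a b = a).
    (* [abs_tensor] matches its first argument first, so right neutrality of ∞ needs a case
       split. *)
    by case: (recip_rel_abs delta a).
  by apply/val_inj; rewrite /= b0 addr0.
rewrite (recip_rel_abs_pos _ a x) // (recip_rel_abs_pos _ b y) //.
rewrite (recip_rel_abs_pos _ _ (x%:num + y%:num)%:pos) /= ?ax ?bx //.
congr Some; apply/val_inj => /=; field.
(* The denominator left by [field] is a sum with a common factor; factored, it is a product of
   positive terms. *)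
by rewrite -mulrDr !mulf_neq0 ?gt_eqF.
Qed.

Theorem mainTheorem2 (delta : {posnum rat}) :
  bijective (recip_abs_rel delta)
  /\ bijective (recip_rel_abs delta)
  /\ (forall a b : abs_dur,
        abs_prec a b <->
        rel_prec (recip_abs_rel delta a) (recip_abs_rel delta b))
  /\ (forall a b : rel_dur,
        rel_prec a b <->
        abs_prec (recip_rel_abs delta a) (recip_rel_abs delta b))
  /\ (forall a b : rel_dur,
        recip_rel_abs delta (rel_tensor a b) =
        abs_tensor (recip_rel_abs delta a) (recip_rel_abs delta b)).
Proof.
have fK := recip_abs_relK delta; have gK := recip_rel_absK delta.
split; first by exists (recip_rel_abs delta).
split; first by exists (recip_abs_rel delta).
split; first by move=> a b; rewrite recip_abs_rel_mono.
split; last exact: recip_rel_abs_tensor.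
(* Order preservation passes to the inverse map. *)
by move=> a b; rewrite -(recip_abs_rel_mono delta) !gK.
Qed.
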